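(* There exists a cake-division instance with $3$ agents in which no allocation is simultaneously balanced, envy-free (with respect to the agents' subjective utilities), and Pareto optimal (with respect to the agents' subjective utilities). Consequently, there exists a cake-division instance with a market valuation in which no allocation is both envy-free and Pareto optimal with respect to the subjective utilities and also envy-free with respect to the market valuation.
   Context: The cake is the interval $[0,1]$; a piece is a Borel subset of $[0,1]$. A density function is an integrable $f:[0,1]\to\mathbb{R}_{\ge0}$, and the value of a piece $X$ is $f(X)=\int_X f(x)\,dx$. A cake-division instance consists of $n$ agents with subjective density functions $u_1,\dots,u_n$ and (when market values are considered) a market density function $v$. An allocation $A=(A_1,\dots,A_n)$ is a partition of $[0,1]$ into $n$ pieces, pairwise disjoint up to overlaps of Lebesgue measure zero, with $A_i$ given to agent $i$. $A$ is envy-free (EF) with respect to the subjective utilities if $u_i(A_i)\ge u_i(A_j)$ for all agents $i,j$, and EF with respect to the market valuation if $v(A_i)=v(A_j)$ for all $i,j$. $A$ is Pareto optimal (PO) with respect to the subjective utilities if there is no allocation $A'$ with $u_i(A'_i)\ge u_i(A_i)$ for all $i$ and at least one inequality strict. $A$ is balanced if all pieces $A_1,\dots,A_n$ have the same length (Lebesgue measure). *)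

(* Defs.v *)
From HB Require Import structures.
From mathcomp Require Import all_boot all_order all_algebra.
From mathcomp Require Import all_classical all_reals all_analysis.
Set Implicit Arguments.
Unset Strict Implicit.
Unset Printing Implicit Defensive.
Import Order.TTheory GRing.Theory Num.Theory.
Import numFieldNormedType.Exports.
Local Open Scope classical_set_scope.
Local Open Scope ring_scope.

Section CakeDivision.
Context {R : realType}.

Definition cake : set R := `[0, 1].

(* [measurable] on [set R] is the Borel sigma-algebra. *)
Definition piece (X : set R) : Prop := measurable X /\ X `<=` cake.

(* A density on [0, 1] is encoded as a total function [R -> R]; its values
   outside the cake are irrelevant, since pieces are subsets of the cake. *)
Definition density (f : R -> R) : Prop :=
  (@lebesgue_measure R).-integrable cake (EFin \o f) /\
  (forall x, cake x -> 0 <= f x).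

Definition value (f : R -> R) (X : set R) : \bar R :=
  (\int[@lebesgue_measure R]_(x in X) (f x)%:E)%E.

Section Agents.
Context {n : nat}.
Implicit Types (u : 'I_n -> R -> R) (v : R -> R) (A : 'I_n -> set R).

Definition allocation A : Prop :=
  [/\ forall i, piece (A i),
      \bigcup_i A i = cake
    & forall i j, i != j -> lebesgue_measure (A i `&` A j) = 0%E].

Definition envy_free u A : Prop :=
  forall i j, (value (u i) (A j) <= value (u i) (A i))%E.

Definition market_envy_free v A : Prop :=
  forall i j, value v (A i) = value v (A j).

Definition pareto_optimal u A : Prop :=
  ~ exists A', [/\ allocation A',
      forall i, (value (u i) (A i) <= value (u i) (A' i))%E
    & exists i, (value (u i) (A i) < value (u i) (A' i))%E].

Definition balanced A : Prop :=
  forall i j, lebesgue_measure (A i) = lebesgue_measure (A j).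

End Agents.
End CakeDivision.

(* Main.v *)
(** One agent spreads its value uniformly over [0, 2/3], the two others over
    the rest of the cake. Pareto optimality forces the first agent to hold
    almost all of [0, 2/3], but two disjoint pieces of equal length cannot be
    longer than 1/2 each. With the constant market density, market
    envy-freeness is balancedness. *)
Require Import Defs.
From HB Require Import structures.
From mathcomp Require Import all_boot all_order all_algebra.
From mathcomp Require Import all_classical all_reals all_analysis.
From mathcomp Require Import measurable_realfun lra.
Set Implicit Arguments.
Unset Strict Implicit.
Unset Printing Implicit Defensive.
Import Order.TTheory GRing.Theory Num.Theory.
Import numFieldNormedType.Exports.
Local Open Scope classical_set_scope.
Local Open Scope ring_scope.

Section IndicatorDensities.
Context {R : realType}.
Local Notation mu := (@lebesgue_measure R).

Lemma measurable_cake : measurable (@cake R).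
Proof. exact: measurable_itv. Qed.

Lemma lebesgue_measure_cake : mu cake = 1%E.
Proof. by rewrite lebesgue_measure_itv /= lte_fin ltr01 sube0. Qed.

(** A bounded measurable function is integrable on a set of finite measure, and the cake has length
    1. *)
Lemma density_indic (c : R) (B : set R) :
  0 <= c -> measurable B -> density (fun x => c * \1_B x).
Proof.
move=> c0 mB; split=> [|x _]; last by rewrite mulr_ge0.
have fin : (mu cake < +oo)%E by rewrite lebesgue_measure_cake ltry.
apply: (@measurable_bounded_integrable _ _ _ mu (fun x => c * \1_B x) _ measurable_cake fin).
  by apply: measurableT_comp => //; exact: measurable_indic.
exists c; split; first exact: ger0_real.
move=> M cM x _ /=; rewrite normrM (ger0_norm c0) (le_trans _ (ltW cM))//.
by rewrite indicE normr_nat ler_piMr// lern1 leq_b1.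
Qed.

(** Turns every comparison of utilities below into a comparison of lengths. *)
Lemma value_indic (c : R) (B X : set R) :
  0 <= c -> measurable B -> measurable X ->
  value (fun x => c * \1_B x) X = (c%:E * mu (B `&` X))%E.
Proof.
move=> c0 mB mX; rewrite /value.
under eq_integral do rewrite EFinM.
rewrite ge0_integralZl_EFin ?integral_indic//.
by apply/measurable_EFinP; exact: measurable_indic.
Qed.

Lemma value_cst1 (X : set R) :
  measurable X -> value (cst (1 : R)) X = mu X.
Proof. by move=> mX; have := integral_cst mu mX 1%E; rewrite mul1e. Qed.

End IndicatorDensities.

Section Transfer.
Context {R : realType} {n : nat}.
Local Notation mu := (@lebesgue_measure R).
Implicit Types (A : 'I_n -> set R) (L : set R).

Definition transfer (k : 'I_n) L A (i : 'I_n) : set R :=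
  if i == k then A i `|` L else A i `\` L.

(** Points of [L] go to [k] and all others stay with their owners, so the cake remains covered. What
    [k] gains is removed from every other piece, so no new overlap appears. *)
Lemma allocation_transfer k L A :
  piece L -> allocation A -> allocation (transfer k L A).
Proof.
move=> [mL Lcake] [pA covA disjA].
have pT i : piece (transfer k L A i).
  have [mAi Aicake] := pA i; rewrite /transfer; case: ifP => _; split.
  - exact: measurableU.
  - by rewrite subUset.
  - exact: measurableD.
  - by apply: subset_trans Aicake; exact: subDsetl.
split=> // [|i j neq_ij].
  apply/seteqP; split=> [x [i _ Tix]|x xcake]; first exact: (pT i).2.
  have [Lx|nLx] := pselect (L x).
    by exists k => //; rewrite /transfer eqxx; right.
  move: xcake; rewrite -covA => -[i _ Aix].
  by exists i => //; rewrite /transfer; case: ifP => _; [left|split].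
(* The new overlap is contained in the old one, which is null. *)
apply: (@subset_measure0 _ _ _ mu _ (A i `&` A j)); last exact: disjA.
- by apply: measurableI; [exact: (pT i).1 | exact: (pT j).1].
- by apply: measurableI; [exact: (pA i).1 | exact: (pA j).1].
rewrite /transfer; case: ifP => [/eqP ik|_]; case: ifP => [/eqP jk|_].
- by move: neq_ij; rewrite ik jk eqxx.
- by move=> x [[Aix|Lx] [Ajx nLx]].
- by move=> x [[Aix nLx] [Ajx|Lx]].
- by move=> x [[? _] [? _]].
Qed.

(** The overlap is null, so the lengths of the two pieces add up to the length of their union, at
    most 1. *)
Lemma balanced_measure_le A (i j : 'I_n) :
  i != j -> allocation A -> balanced A -> (mu (A i) <= (2^-1)%:E)%E.
Proof.
move=> neq_ij [pA _ disjA] balA.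
have le_cake X : measurable X -> X `<=` cake -> (mu X <= 1)%E.
  move=> mX XC; rewrite -lebesgue_measure_cake le_measure ?inE//.
  exact: measurable_cake.
have [[mi iC] [mj jC]] := (pA i, pA j).
(* Finiteness allows the subtraction in the union formula and later rules out the value [+oo]. *)
have fin : (mu (A i) < +oo)%E.
  by rewrite (le_lt_trans (le_cake _ mi iC))// ltry.
have UE : mu (A i `|` A j) = (mu (A i) + mu (A j))%E.
  by rewrite measureUfinl// [X in (_ - X)%E](disjA _ _ neq_ij) sube0.
have : (mu (A i `|` A j) <= 1)%E.
  by apply: le_cake; [exact: measurableU | rewrite subUset].
rewrite UE (balA j i); case: (mu (A i)) fin => //= [r _|_ _]; last by rewrite leNye.
by rewrite -EFinD !lee_fin => ?; lra.
Qed.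

End Transfer.

Section Counterexample.
Context {R : realType}.
Local Notation mu := (@lebesgue_measure R).

Definition prized : set R := `[0, 2/3].
(** Open at [2/3], so that it is strictly disjoint from [prized], not merely up to a null set. *)
Definition remainder : set R := `]2/3, 1].

(** The factors [3/2] and [3] give the whole cake value 1 for every agent. *)
Definition utility (i : 'I_3) : R -> R :=
  if i == ord0 then fun x => 3/2 * \1_prized x
  else fun x => 3 * \1_remainder x.

Lemma density_utility i : density (utility i).
Proof.
rewrite /utility; case: ifP => _; apply: density_indic;
  by [lra | exact: measurable_itv].
Qed.

(** Handing all of [prized] to agent [ord0] is a Pareto improvement: that agent strictly gains, and
    the others lose only cake they value at zero. *)
Lemma balanced_not_pareto_optimal (A : 'I_3 -> set R) :
  allocation A -> balanced A -> ~ pareto_optimal utility A.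
Proof.
move=> allocA balA; apply.
have mP : measurable prized by exact: measurable_itv.
have mr : measurable remainder by exact: measurable_itv.
have pP : piece prized.
  split=> // x; rewrite /cake /prized /= !in_itv /= => /andP[-> /= ?]; lra.
have allocT := allocation_transfer ord0 pP allocA.
have mA i : measurable (A i) by case: allocA => /(_ i) [].
have mT i : measurable (transfer ord0 prized A i) by case: allocT => /(_ i) [].
have gain : (value (utility ord0) (A ord0) <
             value (utility ord0) (transfer ord0 prized A ord0))%E.
  rewrite /utility eqxx (value_indic _ mP (mA _)) ?(value_indic _ mP (mT _)) ?divr_ge0//.
  rewrite lte_pmul2l ?lte_fin ?divr_gt0//.
  rewrite /transfer eqxx setIUr setIid setUidr; last exact: subIsetl.
  (* The bound [1/2] separates the two lengths: agent [ord0] held at most [1/2] of [prized], whose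
     length is [2/3]. Here [ord_max] serves as any second agent. *)
  apply: (@le_lt_trans _ _ (2^-1)%:E).
    apply: le_trans (@balanced_measure_le _ _ _ ord0 ord_max _ allocA balA) => //.
    exact: (measureIr mu mP (mA _)).
  rewrite /prized lebesgue_measure_itv /= lte_fin ifT; last lra.
  by rewrite sube0 lte_fin; lra.
exists (transfer ord0 prized A); split=> //; last by exists ord0.
move=> i; have [->|i0] := eqVneq i ord0; first exact: ltW.
rewrite /utility (negbTE i0) (value_indic _ mr (mA _)) ?(value_indic _ mr (mT _))//.
(* Removing [prized] leaves the part of the piece inside [remainder] unchanged. *)
rewrite /transfer (negbTE i0) setIDA setDidl//.
apply/seteqP; split=> // x [[]]; rewrite /remainder /prized /= !in_itv /=.
by move=> /andP[gt23 _] _ /andP[_]; rewrite leNgt gt23.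
Qed.

End Counterexample.

Theorem theorem13 (R : realType) :
  (exists u : 'I_3 -> R -> R,
     (forall i, density (u i)) /\
     ~ (exists A : 'I_3 -> set R,
          [/\ allocation A, balanced A, envy_free u A & pareto_optimal u A]))
  /\
  (exists (n : nat) (u : 'I_n -> R -> R) (v : R -> R),
     [/\ (0 < n)%N, (forall i, density (u i)), density v &
     ~ (exists A : 'I_n -> set R,
          [/\ allocation A, envy_free u A, pareto_optimal u A
            & market_envy_free v A])]).
Proof.
split.
  exists utility; split=> [|[A [allocA balA _]]]; first exact: density_utility.
  exact: balanced_not_pareto_optimal.
exists 3%N, utility, (cst 1); split=> //.
- exact: density_utility.
(* The constant density is recast as the indicator of the whole line. *)
- rewrite (_ : cst 1 = fun x => 1 * \1_setT x); first exact: density_indic.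
  by apply/funext => x; rewrite indicT mulr1.
- move=> [A [allocA _ poA mefA]]; apply: balanced_not_pareto_optimal poA => //.
  have mA i : measurable (A i) by case: allocA => /(_ i) [].
  by move=> i j; rewrite -!value_cst1//; exact: mefA.
Qed.
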